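(* Let $\hat Q$ be the group of unit-length quaternions under multiplication. There do not exist a monoid $M$, a qubit graphical calculus, and a faithful model of $\mathrm{monoid\text{-}prop}_M$ in that calculus such that the resulting monoid action on states, $(\llbracket a\rrbracket,\llbracket b\rrbracket)\mapsto\llbracket\mu\rrbracket(\llbracket a\rrbracket\otimes\llbracket b\rrbracket)$ on the set $\{\llbracket a\rrbracket:a\in M\}\subset\mathbb C^2$, is isomorphic to the group multiplication of $\hat Q$.
   Context: For a monoid $M$ with unit $e$, $\mathrm{monoid\text{-}prop}_M$ is the PROP generated by a multiplication gate $\mu:2\to1$ and a state $a:0\to1$ for each $a\in M$, with the rewrite rules (for all $a,b,c\in M$): $\mu\circ(e\otimes a)=a=\mu\circ(a\otimes e)$, and $\mu\circ\big((\mu\circ(a\otimes b))\otimes c\big)=\mu\circ\big(a\otimes(\mu\circ(b\otimes c))\big)$. A qubit graphical calculus is a PROP $G$ of diagrams with a strict symmetric monoidal interpretation functor $\llbracket\cdot\rrbracket$ sending a diagram $n\to m$ to a linear map $(\mathbb C^2)^{\otimes n}\to(\mathbb C^2)^{\otimes m}$ (respecting the rules of $G$). A model of $\mathrm{monoid\text{-}prop}_M$ in $G$ is a morphism of PROPs (strict symmetric monoidal functor, identity on objects) $\mathrm{monoid\text{-}prop}_M\to G$; $\llbracket\mu\rrbracket$ and $\llbracket a\rrbracket$ denote the interpretations of the images of the generators. The model is faithful if no two distinct generators of $\mathrm{monoid\text{-}prop}_M$ are sent to the same linear map by the composite of the model with $\llbracket\cdot\rrbracket$. *)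

(* Defs.v *)
From HB Require Import structures.
From mathcomp Require Import all_boot all_order all_algebra.
From mathcomp Require Import generic_quotient complex mxtens.
From mathcomp Require Import boolp classical_sets functions reals.
From mathcomp Require Import ring zify.

Set Implicit Arguments.
Unset Strict Implicit.
Unset Printing Implicit Defensive.

Import Order.TTheory GRing.Theory Num.Theory.

Local Open Scope quotient_scope.
Local Open Scope nat_scope.

(* Transport along equalities of the arities, needed because + on nat is      *)
(* associative and right-unital only propositionally.                         *)
Definition hom_cast (H : nat -> nat -> Type) n m n' m'
    (en : n = n') (em : m = m') (f : H n m) : H n' m' :=
  ecast k (H n' k) em (ecast k (H k m) en f).

(* The laws are stated up to a family of relations E, so that they describe   *)
(* both genuine PROPs (E is equality) and the congruence on formal terms.     *)
(* comp g f is g o f; swap n m is the symmetry n + m -> m + n.                *)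
Record PROP_laws (H : nat -> nat -> Type)
    (E : forall n m, H n m -> H n m -> Prop)
    (id : forall n, H n n)
    (comp : forall n m k, H m k -> H n m -> H n k)
    (tens : forall n m n' m', H n m -> H n' m' -> H (n + n') (m + m'))
    (swap : forall n m, H (n + m) (m + n)) : Prop := PROPLaws {
  law_compA : forall n m k l (h : H k l) (g : H m k) (f : H n m),
    E _ _ (comp _ _ _ h (comp _ _ _ g f)) (comp _ _ _ (comp _ _ _ h g) f);
  law_comp1f : forall n m (f : H n m), E _ _ (comp _ _ _ (id m) f) f;
  law_compf1 : forall n m (f : H n m), E _ _ (comp _ _ _ f (id n)) f;
  law_tens_id : forall n m, E _ _ (tens _ _ _ _ (id n) (id m)) (id (n + m));
  law_tens_comp : forall n m k n' m' k' (g : H m k) (f : H n m)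
      (g' : H m' k') (f' : H n' m'),
    E _ _ (tens _ _ _ _ (comp _ _ _ g f) (comp _ _ _ g' f'))
          (comp _ _ _ (tens _ _ _ _ g g') (tens _ _ _ _ f f'));
  law_tensA : forall n m n' m' n'' m''
      (f : H n m) (g : H n' m') (h : H n'' m''),
    E _ _ (hom_cast (addnA n n' n'') (addnA m m' m'')
             (tens _ _ _ _ f (tens _ _ _ _ g h)))
          (tens _ _ _ _ (tens _ _ _ _ f g) h);
  law_tens0f : forall n m (f : H n m), E _ _ (tens _ _ _ _ (id 0) f) f;
  law_tensf0 : forall n m (f : H n m),
    E _ _ (hom_cast (addn0 n) (addn0 m) (tens _ _ _ _ f (id 0))) f;
  law_swap_nat : forall n m n' m' (f : H n m) (g : H n' m'),
    E _ _ (comp _ _ _ (swap m m') (tens _ _ _ _ f g))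
          (comp _ _ _ (tens _ _ _ _ g f) (swap n n'));
  law_swapK : forall n m,
    E _ _ (comp _ _ _ (swap m n) (swap n m)) (id (n + m));
  law_swapD : forall n m k,
    E _ _ (hom_cast (addnA n m k) (esym (addnA m k n)) (swap n (m + k)))
          (comp _ _ _ (tens _ _ _ _ (id m) (swap n k))
             (hom_cast (erefl (n + m + k)) (esym (addnA m n k))
                (tens _ _ _ _ (swap n m) (id k))))
}.

Record PROP := MkPROP {
  hom :> nat -> nat -> Type;
  idd : forall n, hom n n;
  comp : forall n m k, hom m k -> hom n m -> hom n k;
  tens : forall n m n' m', hom n m -> hom n' m' -> hom (n + n') (m + m');
  swap : forall n m, hom (n + m) (m + n);
  PROP_lawsP : PROP_laws (fun n m => @eq (hom n m)) idd comp tens swap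
}.

Arguments idd {p} n.
Arguments comp {p n m k} g f : rename.
Arguments tens {p n m n' m'} f g : rename.
Arguments swap {p} n m.

(* Strict symmetric monoidal functors that are the identity on objects. *)
Record PROP_morphism (G G' : PROP) := PROPMorphism {
  app : forall n m, G n m -> G' n m;
  app_id : forall n, app (idd n) = idd n;
  app_comp : forall n m k (g : G m k) (f : G n m),
    app (comp g f) = comp (app g) (app f);
  app_tens : forall n m n' m' (f : G n m) (g : G n' m'),
    app (tens f g) = tens (app f) (app g);
  app_swap : forall n m, app (swap n m) = swap n m
}.

Arguments app {G G'} p {n m} f : rename.

Inductive term (Sig : nat -> nat -> Type) : nat -> nat -> Type :=
| tgen n m : Sig n m -> term Sig n m
| tid n : term Sig n n
| tcomp n m k : term Sig m k -> term Sig n m -> term Sig n k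
| ttens n m n' m' :
    term Sig n m -> term Sig n' m' -> term Sig (n + n') (m + m')
| tswap n m : term Sig (n + m) (m + n).

Arguments tgen {Sig n m} _.
Arguments tid {Sig} n.
Arguments tcomp {Sig n m k} g f : rename.
Arguments ttens {Sig n m n' m'} f g : rename.
Arguments tswap {Sig} n m.

Definition term_rel Sig := forall n m, term Sig n m -> term Sig n m -> Prop.

Record PROP_congruence Sig (E : term_rel Sig) : Prop := PROPCongruence {
  cong_refl : forall n m (t : term Sig n m), E _ _ t t;
  cong_sym : forall n m (t u : term Sig n m), E _ _ t u -> E _ _ u t;
  cong_trans : forall n m (t u v : term Sig n m),
    E _ _ t u -> E _ _ u v -> E _ _ t v;
  cong_comp : forall n m k (g g' : term Sig m k) (f f' : term Sig n m),
    E _ _ g g' -> E _ _ f f' -> E _ _ (tcomp g f) (tcomp g' f');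
  cong_tens : forall n m n' m' (f f' : term Sig n m) (g g' : term Sig n' m'),
    E _ _ f f' -> E _ _ g g' -> E _ _ (ttens f g) (ttens f' g');
  cong_laws : PROP_laws E (@tid Sig) (@tcomp Sig) (@ttens Sig) (@tswap Sig)
}.

(* The least congruence containing the rules. *)
Definition rewr Sig (rules : term_rel Sig) : term_rel Sig :=
  fun n m t u => forall E : term_rel Sig, PROP_congruence E ->
    (forall k l (a b : term Sig k l), rules k l a b -> E k l a b) ->
    E n m t u.

Lemma rewr_congruence Sig (rules : term_rel Sig) :
  PROP_congruence (rewr rules).
Proof.
split.
- by move=> n m t E cE _; apply: cong_refl.
- by move=> n m t u tu E cE rE; apply: cong_sym => //; apply: tu.
- move=> n m t u v tu uv E cE rE.
  by apply: (cong_trans cE (tu E cE rE) (uv E cE rE)).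
- move=> n m k g g' f f' gg ff E cE rE.
  by apply: (cong_comp cE (gg E cE rE) (ff E cE rE)).
- move=> n m n' m' f f' g g' ff gg E cE rE.
  by apply: (cong_tens cE (ff E cE rE) (gg E cE rE)).
split; intros; move=> E cE _; case: (cong_laws cE); auto.
Qed.

HB.instance Definition _ Sig n m := gen_eqMixin (term Sig n m).
HB.instance Definition _ Sig n m := gen_choiceMixin (term Sig n m).

Lemma rewr_refl Sig (rules : term_rel Sig) n m :
  reflexive (fun t u : term Sig n m => `[< rewr rules t u >]).
Proof.
by move=> t; apply/asboolP; exact: cong_refl (rewr_congruence rules) _ _ t.
Qed.

Lemma rewr_sym Sig (rules : term_rel Sig) n m :
  symmetric (fun t u : term Sig n m => `[< rewr rules t u >]).
Proof.
move=> t u; apply/asboolP/asboolP;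
by apply: (cong_sym (rewr_congruence rules)).
Qed.

Lemma rewr_trans Sig (rules : term_rel Sig) n m :
  transitive (fun t u : term Sig n m => `[< rewr rules t u >]).
Proof.
move=> u t v /asboolP tu /asboolP uv; apply/asboolP.
exact: (cong_trans (rewr_congruence rules) tu uv).
Qed.

Definition rewr_equiv Sig (rules : term_rel Sig) n m :=
  EquivRel (fun t u : term Sig n m => `[< rewr rules t u >])
    (@rewr_refl Sig rules n m) (@rewr_sym Sig rules n m)
    (@rewr_trans Sig rules n m).

Definition diagram Sig (rules : term_rel Sig) n m : Type :=
  {eq_quot (rewr_equiv rules n m)}.

Definition diag Sig (rules : term_rel Sig) n m (t : term Sig n m) :
  diagram rules n m := \pi_({eq_quot (rewr_equiv rules n m)})%qT t.

Definition undiag Sig (rules : term_rel Sig) n m (d : diagram rules n m) :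
  term Sig n m := repr (d : {eq_quot (rewr_equiv rules n m)}).

Lemma undiagK Sig (rules : term_rel Sig) n m (d : diagram rules n m) :
  diag rules (undiag d) = d.
Proof. exact: reprK. Qed.

Lemma diagP Sig (rules : term_rel Sig) n m (t u : term Sig n m) :
  diag rules t = diag rules u <-> rewr rules t u.
Proof.
by split=> [/eqmodP/asboolP //|tu]; apply/eqmodP/asboolP.
Qed.

Lemma diag_eq Sig (rules : term_rel Sig) n m (t u : term Sig n m) :
  rewr rules t u -> diag rules t = diag rules u.
Proof. by move/diagP. Qed.

Lemma rewr_undiag Sig (rules : term_rel Sig) n m (t : term Sig n m) :
  rewr rules (undiag (diag rules t)) t.
Proof. by apply/diagP; rewrite undiagK. Qed.

Definition dcomp Sig (rules : term_rel Sig) n m k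
    (g : diagram rules m k) (f : diagram rules n m) : diagram rules n k :=
  diag rules (tcomp (undiag g) (undiag f)).

Definition dtens Sig (rules : term_rel Sig) n m n' m'
    (f : diagram rules n m) (g : diagram rules n' m') :
  diagram rules (n + n') (m + m') :=
  diag rules (ttens (undiag f) (undiag g)).

Lemma dcompE Sig (rules : term_rel Sig) n m k
    (g : term Sig m k) (f : term Sig n m) :
  dcomp (diag rules g) (diag rules f) = diag rules (tcomp g f).
Proof.
apply: diag_eq; apply: (cong_comp (rewr_congruence rules));
exact: rewr_undiag.
Qed.

Lemma dtensE Sig (rules : term_rel Sig) n m n' m'
    (f : term Sig n m) (g : term Sig n' m') :
  dtens (diag rules f) (diag rules g) = diag rules (ttens f g).
Proof.
apply: diag_eq; apply: (cong_tens (rewr_congruence rules));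
exact: rewr_undiag.
Qed.

Lemma diag_cast Sig (rules : term_rel Sig) n m n' m'
    (en : n = n') (em : m = m') (t : term Sig n m) :
  hom_cast en em (diag rules t) = diag rules (hom_cast en em t).
Proof. by case: n' / en; case: m' / em. Qed.

Lemma diagram_laws Sig (rules : term_rel Sig) :
  PROP_laws (fun n m => @eq (diagram rules n m))
    (fun n => diag rules (tid n)) (@dcomp Sig rules) (@dtens Sig rules)
    (fun n m => diag rules (tswap n m)).
Proof.
have L := cong_laws (rewr_congruence rules).
split; intros;
  repeat match goal with
  | d : diagram _ _ _ |- _ => rewrite -(undiagK d); move: (undiag d) => {}d
  end;
  rewrite ?(dcompE, dtensE, diag_cast); apply: diag_eq;
  by case: L => *; auto.
Qed.

(* The PROP presented by generators Sig and rewrite rules. *)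
Definition presented_PROP Sig (rules : term_rel Sig) : PROP :=
  MkPROP (diagram_laws rules).

Inductive monoid_gen (M : monoidType) : nat -> nat -> Type :=
| gmul : monoid_gen M 2 1
| gst : M -> monoid_gen M 0 1.

Arguments gmul {M}.
Arguments gst {M} a.

Definition tmul (M : monoidType) : term (monoid_gen M) 2 1 := tgen gmul.
Definition tst (M : monoidType) (a : M) : term (monoid_gen M) 0 1 :=
  tgen (gst a).

Arguments tmul {M}.

(* Only the unit of M occurs in the rules: there is no rule rewriting          *)
(* mul o (a (x) b) to the state a * b.                                        *)
Inductive monoid_rules (M : monoidType) : term_rel (monoid_gen M) :=
| rule_mul1 a :
    monoid_rules (tcomp tmul (ttens (tst 1%g) (tst a))) (tst a)
| rule_mulr1 a :
    monoid_rules (tcomp tmul (ttens (tst a) (tst 1%g))) (tst a)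
| rule_mulA a b c :
    monoid_rules
      (tcomp tmul (ttens (tcomp tmul (ttens (tst a) (tst b))) (tst c)))
      (tcomp tmul (ttens (tst a) (tcomp tmul (ttens (tst b) (tst c))))).

Definition monoid_prop (M : monoidType) : PROP :=
  presented_PROP (@monoid_rules M).

Definition mgen (M : monoidType) n m (g : monoid_gen M n m) :
  monoid_prop M n m := diag (@monoid_rules M) (tgen g).

Local Open Scope ring_scope.

(* A linear map (C^2)^{(x) n} -> (C^2)^{(x) m} is given by its matrix in the   *)
(* standard bases (acting on column vectors), the basis vector                *)
(* e_(b_1) (x) ... (x) e_(b_n) having the binary number b_1...b_n as index.   *)
Definition qmap (R : realType) n m : Type := 'M[R[i]]_(2 ^ m, 2 ^ n).

Definition qid (R : realType) n : qmap R n n := 1%:M.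

Definition qcomp (R : realType) n m k (g : qmap R m k) (f : qmap R n m) :
  qmap R n k := g *m f.

Definition qtens (R : realType) n m n' m' (f : qmap R n m) (g : qmap R n' m') :
  qmap R (n + n') (m + m') :=
  castmx (esym (expnD 2 m m'), esym (expnD 2 n n')) (f *t g).

(* v (x) w |-> w (x) v *)
Definition qswap (R : realType) n m : qmap R (n + m) (m + n) :=
  castmx (esym (expnD 2 m n), esym (expnD 2 n m))
    (\matrix_(i < 2 ^ m * 2 ^ n, j < 2 ^ n * 2 ^ m)
       (mxtens_unindex i ==
          ((mxtens_unindex j).2, (mxtens_unindex j).1))%:R).


Definition qjoin n m (xy : 'I_(2 ^ n) * 'I_(2 ^ m)) : 'I_(2 ^ (n + m)) :=
  cast_ord (esym (expnD 2 n m)) (mxtens_index xy).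

Definition qsplit n m (i : 'I_(2 ^ (n + m))) : 'I_(2 ^ n) * 'I_(2 ^ m) :=
  mxtens_unindex (cast_ord (expnD 2 n m) i).

Definition qflip n m (i : 'I_(2 ^ (n + m))) : 'I_(2 ^ (m + n)) :=
  qjoin ((qsplit i).2, (qsplit i).1).

Definition fun_mx (R : realType) n m (s : 'I_(2 ^ n) -> 'I_(2 ^ m)) :
  qmap R n m := \matrix_(i, j) (i == s j)%:R.

Lemma qjoinK n m : cancel (@qjoin n m) (@qsplit n m).
Proof. by move=> xy; rewrite /qsplit /qjoin cast_ordKV mxtens_indexK. Qed.

Lemma qsplitK n m : cancel (@qsplit n m) (@qjoin n m).
Proof. by move=> i; rewrite /qsplit /qjoin mxtens_unindexK cast_ordK. Qed.

Lemma qflipK n m : cancel (@qflip n m) (@qflip m n).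
Proof.
by move=> i; rewrite -[RHS]qsplitK /qflip qjoinK; case: (qsplit i).
Qed.

Lemma qtensE (R : realType) n m n' m' (f : qmap R n m) (g : qmap R n' m') i j :
  qtens f g i j = f (qsplit i).1 (qsplit j).1 * g (qsplit i).2 (qsplit j).2.
Proof. by rewrite /qtens castmxE mxE !esymK. Qed.

Lemma qidE (R : realType) n : qid R n = fun_mx R (fun i => i).
Proof. by apply/matrixP => i j; rewrite !mxE. Qed.

Lemma qswapE (R : realType) n m : qswap R n m = fun_mx R (@qflip n m).
Proof.
apply/matrixP => i j; rewrite castmxE !mxE !esymK; congr (_%:R); congr nat_of_bool.
by rewrite -(can_eq (@qsplitK m n)) /qflip qjoinK.
Qed.

Lemma fun_mxM (R : realType) n m k (A : qmap R m k)
    (s : 'I_(2 ^ n) -> 'I_(2 ^ m)) i j :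
  qcomp A (fun_mx R s) i j = A i (s j).
Proof.
rewrite mxE (bigD1 (s j)) //= mxE eqxx mulr1 big1 ?addr0 // => k' /negPf ne.
by rewrite mxE ne mulr0.
Qed.

Lemma fun_mxMl (R : realType) n m k (A : qmap R n m)
    (s : 'I_(2 ^ m) -> 'I_(2 ^ k)) (t : 'I_(2 ^ k) -> 'I_(2 ^ m)) i j :
  cancel s t -> cancel t s -> qcomp (fun_mx R s) A i j = A (t i) j.
Proof.
move=> st ts; rewrite mxE (bigD1 (t i)) //= mxE ts eqxx mul1r.
rewrite big1 ?addr0 // => k' /negPf ne; rewrite mxE.
by rewrite -(can_eq ts) st eq_sym ne mul0r.
Qed.

Lemma fun_mx_comp (R : realType) n m k (s : 'I_(2 ^ m) -> 'I_(2 ^ k))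
    (t : 'I_(2 ^ n) -> 'I_(2 ^ m)) :
  qcomp (fun_mx R s) (fun_mx R t) = fun_mx R (s \o t).
Proof. by apply/matrixP => i j; rewrite fun_mxM !mxE. Qed.

Lemma fun_mx_tens (R : realType) n m n' m' (s : 'I_(2 ^ n) -> 'I_(2 ^ m))
    (t : 'I_(2 ^ n') -> 'I_(2 ^ m')) :
  qtens (fun_mx R s) (fun_mx R t) =
  fun_mx R (fun j => qjoin (s (qsplit j).1, t (qsplit j).2)).
Proof.
apply/matrixP => i j; rewrite qtensE !mxE -natrM mulnb -xpair_eqE.
by rewrite -surjective_pairing -(can_eq (@qjoinK m m')) qsplitK.
Qed.

Lemma qcastE (R : realType) n m n' m' (en : n = n') (em : m = m')
    (f : qmap R n m) i j :
  hom_cast en em f i j =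
  f (cast_ord (congr1 (expn 2) (esym em)) i)
    (cast_ord (congr1 (expn 2) (esym en)) j).
Proof. by case: n' / en j; case: m' / em i => i j; rewrite !cast_ord_id. Qed.

Lemma qcast_fun (R : realType) n m n' m' (en : n = n') (em : m = m')
    (s : 'I_(2 ^ n) -> 'I_(2 ^ m)) :
  hom_cast en em (fun_mx R s) =
  fun_mx R (fun j => cast_ord (congr1 (expn 2) em)
                       (s (cast_ord (congr1 (expn 2) (esym en)) j))).
Proof.
case: n' / en; case: m' / em => /=; apply/matrixP => i j.
by rewrite !mxE !cast_ord_id.
Qed.

Lemma qmap_laws (R : realType) :
  PROP_laws (fun n m => @eq (qmap R n m)) (@qid R) (@qcomp R) (@qtens R)
    (@qswap R).
Proof.
split.
- by move=> *; apply: mulmxA.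
- by move=> *; apply: mul1mx.
- by move=> *; apply: mulmx1.
- move=> n m; rewrite !qidE fun_mx_tens; congr fun_mx; apply/funext => j.
  by rewrite -surjective_pairing qsplitK.
- move=> n m k n' m' k' g f g' f'.
  apply/matrixP => i j; rewrite qtensE !mxE big_distrlr /=.
  rewrite pair_big /= [RHS](reindex (@qjoin m m')); last first.
    by exists (@qsplit m m') => ? _; rewrite ?qjoinK ?qsplitK.
  by apply: eq_bigr => -[x y] _; rewrite !qtensE qjoinK /= mulrACA.
- move=> n m n' m' n'' m'' f g h; apply/matrixP => i j.
  rewrite qcastE !qtensE mulrA.
  have E a b c (l : 'I_(2 ^ (a + b + c))) :
      let l' := cast_ord (congr1 (expn 2) (esym (addnA a b c))) l in
      [/\ (qsplit (qsplit l).1).1 = (qsplit l').1,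
          (qsplit (qsplit l).1).2 = (qsplit (qsplit l').2).1 &
          (qsplit l).2 = (qsplit (qsplit l').2).2].
    rewrite /=; split; apply: val_inj => /=; move: (nat_of_ord l) => x.
    + by rewrite -divnMA expnD mulnC.
    + by rewrite expnD modn_divl.
    + by rewrite expnD modn_dvdm ?dvdn_mull.
  by have [-> -> ->] := E _ _ _ i; have [-> -> ->] := E _ _ _ j.
- move=> n m f; apply/matrixP => i j.
  rewrite qtensE qidE mxE.
  rewrite (_ : (qsplit i).1 == _); last first.
    by apply/eqP/val_inj => /=; rewrite !divn_small.
  by rewrite mul1r; congr (f _ _); apply: val_inj => /=; rewrite modn_small.
- move=> n m f; apply/matrixP => i j.
  rewrite qcastE qtensE qidE mxE.
  rewrite (_ : (qsplit (cast_ord _ i)).2 == _); last first.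
    by apply/eqP/val_inj => /=; rewrite !modn1.
  by rewrite mulr1; congr (f _ _); apply: val_inj => /=; rewrite divn1.
- move=> n m n' m' f g; apply/matrixP => i j.
  rewrite !qswapE fun_mxM.
  rewrite (fun_mxMl _ _ _ (@qflipK m m') (@qflipK m' m)).
  by rewrite !qtensE /qflip !qjoinK /= mulrC.
- move=> n m; rewrite !qswapE fun_mx_comp qidE.
  by congr fun_mx; apply/funext => j /=; rewrite qflipK.
move=> n m k; rewrite !qswapE !qidE !fun_mx_tens !qcast_fun fun_mx_comp.
congr fun_mx; apply/funext => j /=; apply: val_inj => /=.
have jlt : (j < 2 ^ k * 2 ^ m * 2 ^ n)%N.
  by case: j => j /= jl; rewrite -!expnD (leq_trans jl) // leq_exp2l //; lia.
move: {j} (nat_of_ord j) jlt => j jlt.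
rewrite !expnD ![(2 ^ m * 2 ^ k)%N]mulnC divnMA.
have: (j %% (2 ^ k * 2 ^ m) =
       (j %/ 2 ^ k) %% 2 ^ m * 2 ^ k + j %% 2 ^ k)%N.
  rewrite modn_divl [(2 ^ m * 2 ^ k)%N]mulnC.
  by rewrite [LHS](divn_eq _ (2 ^ k)) modn_dvdm // dvdn_mulr.
move=> ->.
have: (j %/ 2 ^ k %/ 2 ^ m < 2 ^ n)%N.
  by rewrite -divnMA ltn_divLR ?muln_gt0 ?expn_gt0 // [(2 ^ n * _)%N]mulnC.
have: (j %% 2 ^ k < 2 ^ k)%N by rewrite ltn_mod expn_gt0.
move: (j %/ 2 ^ k %/ 2 ^ m)%N (j %% 2 ^ k)%N ((j %/ 2 ^ k) %% 2 ^ m)%N.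
move: (2 ^ n)%N (2 ^ k)%N => N K x z y zK xN.
have xzNK : (x * K + z < N * K)%N by nia.
rewrite (_ : ((y * N + x) * K + z = y * (N * K) + (x * K + z))%N); last by ring.
have NK0 : (0 < N * K)%N by lia.
rewrite divnMDl // divn_small // modnMDl [((_ + _) %% (_ * _))%N]modn_small //.
rewrite modnMDl divnMDl ?(leq_ltn_trans _ zK) // modn_small // divn_small //.
by ring.
Qed.

Definition Qubit (R : realType) : PROP := MkPROP (qmap_laws R).

Record qubit_calculus (R : realType) := QubitCalculus {
  calculus :> PROP;
  interp : PROP_morphism calculus (Qubit R)
}.

(* The linear map assigned to a generator of monoid_prop M by a model F. *)
Definition sem (R : realType) (M : monoidType) (G : qubit_calculus R)
    (F : PROP_morphism (monoid_prop M) G) n m (g : monoid_gen M n m) :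
  Qubit R n m := app (interp G) (app F (mgen g)).

(* Generators of different arities are sent to maps of different types.       *)
Definition faithful (R : realType) (M : monoidType) (G : qubit_calculus R)
    (F : PROP_morphism (monoid_prop M) G) : Prop :=
  forall n m (g h : monoid_gen M n m), sem F g = sem F h -> g = h.

Definition states (R : realType) (M : monoidType) (G : qubit_calculus R)
    (F : PROP_morphism (monoid_prop M) G) : set (Qubit R 0 1) :=
  [set sem F (gst a) | a in [set: M]].

Definition action (R : realType) (M : monoidType) (G : qubit_calculus R)
    (F : PROP_morphism (monoid_prop M) G) (v w : Qubit R 0 1) : Qubit R 0 1 :=
  comp (sem F gmul) (tens v w).

(* In particular S is closed under op. *)
Definition isomorphic_to (T : Type) (S : set T) (op : T -> T -> T)
    (H : magmaType) : Prop :=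
  exists f : H -> T,
    set_bij [set: H] S f /\ forall x y, f (x * y)%g = op (f x) (f y).

Record quaternion (R : realType) := Quaternion {
  qre : R; qi : R; qj : R; qk : R
}.

Definition quat_tuple (R : realType) (p : quaternion R) : R * R * R * R :=
  (qre p, qi p, qj p, qk p).

Definition tuple_quat (R : realType) (t : R * R * R * R) : quaternion R :=
  let: (a, b, c, d) := t in Quaternion a b c d.

Lemma quat_tupleK (R : realType) :
  cancel (@quat_tuple R) (@tuple_quat R).
Proof. by case. Qed.

HB.instance Definition _ (R : realType) :=
  Choice.copy (quaternion R) (can_type (@quat_tupleK R)).

Definition quat1 (R : realType) : quaternion R := Quaternion 1 0 0 0.

Definition quat_mul (R : realType) (p q : quaternion R) : quaternion R :=
  let: Quaternion a b c d := p in
  let: Quaternion a' b' c' d' := q in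
  Quaternion (a * a' - b * b' - c * c' - d * d')
             (a * b' + b * a' + c * d' - d * c')
             (a * c' - b * d' + c * a' + d * b')
             (a * d' + b * c' - c * b' + d * a').

Definition quat_conj (R : realType) (p : quaternion R) : quaternion R :=
  Quaternion (qre p) (- qi p) (- qj p) (- qk p).

Definition quat_norm (R : realType) (p : quaternion R) : R :=
  Num.sqrt (qre p ^+ 2 + qi p ^+ 2 + qj p ^+ 2 + qk p ^+ 2).

Definition unit_length (R : realType) : pred (quaternion R) :=
  fun p => quat_norm p == 1.

Record unit_quaternion (R : realType) := UnitQuaternion {
  uquat :> quaternion R;
  uquatP : unit_length uquat
}.

HB.instance Definition _ (R : realType) :=
  [isSub for @uquat R].
HB.instance Definition _ (R : realType) :=
  [Choice of unit_quaternion R by <:].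

Lemma quat_mulA (R : realType) : associative (@quat_mul R).
Proof. by move=> [a b c d] [e f g h] [i j k l] /=; congr Quaternion; ring. Qed.

Lemma quat_mul1l (R : realType) : left_id (quat1 R) (@quat_mul R).
Proof. by move=> [a b c d] /=; congr Quaternion; ring. Qed.

Lemma quat_mul1r (R : realType) : right_id (quat1 R) (@quat_mul R).
Proof. by move=> [a b c d] /=; congr Quaternion; ring. Qed.

Lemma quat_normM (R : realType) (p q : quaternion R) :
  quat_norm (quat_mul p q) = quat_norm p * quat_norm q.
Proof.
rewrite /quat_norm -sqrtrM; last by rewrite !addr_ge0 ?sqr_ge0.
by case: p q => [a b c d] [e f g h] /=; congr Num.sqrt; ring.
Qed.

Lemma quat_normJ (R : realType) (p : quaternion R) :
  quat_norm (quat_conj p) = quat_norm p.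
Proof. by rewrite /quat_norm /= !sqrrN. Qed.

Lemma unit_lengthE (R : realType) (p : quaternion R) :
  unit_length p =
  (qre p ^+ 2 + qi p ^+ 2 + qj p ^+ 2 + qk p ^+ 2 == 1).
Proof.
rewrite /unit_length /quat_norm; apply/eqP/eqP => [s1|->]; last exact: sqrtr1.
by rewrite -[LHS]sqr_sqrtr ?s1 ?expr1n // !addr_ge0 ?sqr_ge0.
Qed.

Lemma unit_length1 (R : realType) : unit_length (quat1 R).
Proof. by rewrite unit_lengthE /= !expr2 !mulr0 mulr1 !addr0. Qed.

Lemma unit_lengthM (R : realType) (p q : unit_quaternion R) :
  unit_length (quat_mul p q).
Proof.
by rewrite /unit_length quat_normM (eqP (uquatP p)) (eqP (uquatP q)) mulr1.
Qed.

Lemma unit_lengthJ (R : realType) (p : unit_quaternion R) :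
  unit_length (quat_conj p).
Proof. by rewrite /unit_length quat_normJ (eqP (uquatP p)). Qed.

Definition uquat1 (R : realType) : unit_quaternion R :=
  UnitQuaternion (unit_length1 R).

Definition uquat_mul (R : realType) (p q : unit_quaternion R) :
  unit_quaternion R := UnitQuaternion (unit_lengthM p q).

Definition uquat_inv (R : realType) (p : unit_quaternion R) :
  unit_quaternion R := UnitQuaternion (unit_lengthJ p).

Lemma uquat_mulA (R : realType) : associative (@uquat_mul R).
Proof. by move=> p q r; apply: val_inj; apply: quat_mulA. Qed.

Lemma uquat_mul1l (R : realType) : left_id (uquat1 R) (@uquat_mul R).
Proof. by move=> p; apply: val_inj; apply: quat_mul1l. Qed.

Lemma uquat_mul1r (R : realType) : right_id (uquat1 R) (@uquat_mul R).
Proof. by move=> p; apply: val_inj; apply: quat_mul1r. Qed.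

Lemma uquat_mulVl (R : realType) :
  left_inverse (uquat1 R) (@uquat_inv R) (@uquat_mul R).
Proof.
move=> [p pP]; apply: val_inj => /=; move: pP; rewrite unit_lengthE => /eqP.
case: p => a b c d /= E; rewrite /quat1 -E; congr Quaternion; ring.
Qed.

Lemma uquat_mulVr (R : realType) :
  right_inverse (uquat1 R) (@uquat_inv R) (@uquat_mul R).
Proof.
move=> [p pP]; apply: val_inj => /=; move: pP; rewrite unit_lengthE => /eqP.
case: p => a b c d /= E; rewrite /quat1 -E; congr Quaternion; ring.
Qed.

HB.instance Definition _ (R : realType) :=
  isGroup.Build (unit_quaternion R) (@uquat_mulA R) (@uquat_mul1l R)
    (@uquat_mul1r R) (@uquat_mulVl R) (@uquat_mulVr R).

(* Main.v *)
Require Import Defs.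
From mathcomp Require Import all_boot all_order all_algebra.
From mathcomp Require Import reals.
From mathcomp Require Import boolp classical_sets functions complex.

Set Implicit Arguments.
Unset Strict Implicit.
Unset Printing Implicit Defensive.

Import GRing.Theory Num.Theory.

Local Open Scope ring_scope.

(* The span of the states is a unital algebra for the bilinear product given
   by mu, of dimension at most 2, hence commutative (it is spanned by the unit
   and one further element), whereas i j <> j i among the quaternions. *)

Lemma dim2_unital_comm (K : fieldType) (V : vectType K) (B : V -> V -> V)
    (e u v : V) :
  (forall x, linear (B x)) -> (forall y, linear (B^~ y)) ->
  (\dim {:V} <= 2)%N ->
  B e u = u -> B u e = u -> B e v = v -> B v e = v ->
  B u v = B v u.
Proof.
move=> linr linl dimV eu ue ev ve.
(* Scalar [-1] and zero vectors turn the linearity identity into [B x 0 = - B x 0 + B x 0]. *)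
have B0r x : B x 0 = 0
  by have := linr x (-1) 0 0; rewrite !scaler0 !addr0 scaleN1r addNr.
have B0l x : B 0 x = 0
  by have := linl x (-1) 0 0; rewrite !scaler0 !addr0 scaleN1r addNr.
have BZr a x y : B x (a *: y) = a *: B x y
  by have := linr x a y 0; rewrite B0r !addr0.
have BZl a x y : B (a *: x) y = a *: B x y
  by have := linl y a x 0; rewrite B0l !addr0.
(* If [u = a *: e], both products equal [a *: v]. Otherwise [e] is nonzero, since [e = 0] would
   force [u = B e u = 0]; then [u] and [e] are independent and fill the space. *)
case: (boolP (u \in <[e]>%VS)) => [/vlineP[a ->]|ue'].
  by rewrite BZl BZr ev ve.
have e0 : e != 0 by apply: contraNneq ue' => e0; rewrite -eu e0 B0l mem0v.
have freeue : free [:: u; e] by rewrite free_cons span_seq1 ue' seq1_free.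
have : v \in <<[:: u; e]>>%VS.
  suff -> : (<<[:: u; e]>> = fullv)%VS by exact: memvf.
  by apply/eqP; rewrite eqEdim subvf (eqnP freeue).
rewrite span_cons span_seq1 => /memv_addP[_ /vlineP[a ->] [_ /vlineP[b ->] ->]].
(* For [v = a *: u + b *: e], both sides become [a *: B u u + b *: u]. *)
by rewrite linr linl BZr BZl eu ue.
Qed.

Lemma qtens_linear (R : realType) n m n' m' (f : qmap R n m) :
  linear (@qtens R n m n' m' f).
Proof.
move=> a g h; apply/matrixP => i j.
by rewrite !(qtensE, mxE) mulrDr mulrCA.
Qed.

Lemma qtens_linearl (R : realType) n m n' m' (g : qmap R n' m') :
  linear ((@qtens R n m n' m')^~ g).
Proof.
move=> a f h; apply/matrixP => i j.
by rewrite !(qtensE, mxE) mulrDl mulrA.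
Qed.

Theorem corollary6p11 (R : realType) :
  ~ (exists (M : monoidType) (G : qubit_calculus R)
       (F : PROP_morphism (monoid_prop M) G),
       faithful F /\
       isomorphic_to (states F) (action F) (unit_quaternion R)).
Proof.
move=> [M [G [F [_ [f [[_ f_inj _] fM]]]]]].
have {}f_inj x y : f x = f y -> x = y.
  by apply: f_inj; rewrite in_setE.
have Ui : unit_length (Quaternion (0 : R) 1 0 0).
  by rewrite unit_lengthE /= expr1n !expr0n /= !addr0 add0r.
have Uj : unit_length (Quaternion (0 : R) 0 1 0).
  by rewrite unit_lengthE /= expr1n !expr0n /= !addr0 !add0r.
pose i := UnitQuaternion Ui; pose j := UnitQuaternion Uj.
(* The [qk] components of the two products are 1 and -1. *)
have ij : (i * j <> j * i)%g.
  move=> /(congr1 (fun q : unit_quaternion R => qk q)) /=.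
  rewrite !(mulr0, mul0r, mulr1, subr0, addr0, add0r, sub0r) => /eqP.
  by rewrite eq_sym eqNr oner_eq0.
apply: ij; apply: f_inj; rewrite !fM.
(* [action F] is bilinear on all column vectors of height 2, whereas the unit laws for [f 1] are
   transported by [f] and so hold on its image, which contains [f i] and [f j]. *)
apply: (@dim2_unital_comm _ 'M[R[i]]_(2 ^ 1, 2 ^ 0) (action F) (f 1%g));
  rewrite -?fM ?mulg1 ?mul1g //.
- move=> v a x y; rewrite /action /= /qcomp.
  by rewrite qtens_linear mulmxDr -scalemxAr.
- move=> v a x y; rewrite /action /= /qcomp.
  by rewrite qtens_linearl mulmxDr -scalemxAr.
- by rewrite dimvf.
Qed.
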